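(* Let $X$ be a uniformly convex real Banach space, let $K$ be a nonempty closed convex subset of $X$, and let $m\ge 1$ be an integer. For each $i=1,\dots,m$ let $I_i:K\to K$ be a continuous total asymptotically nonexpansive mapping with sequences $\{\tilde\mu_{in}\}_{n\ge1},\{\tilde\lambda_{in}\}_{n\ge1}$ and function $\varphi_i$, and let $T_i:K\to K$ be a continuous total asymptotically $I_i$-nonexpansive mapping with sequences $\{\mu_{in}\}_{n\ge1},\{\lambda_{in}\}_{n\ge1}$ and function $\phi_i$. Assume that $F:=\bigcap_{i=1}^m\left(F(T_i)\cap F(I_i)\right)\neq\emptyset$. Suppose that for all $i=1,\dots,m$ $$\sum_{n=1}^\infty\mu_{in}<\infty,\quad \sum_{n=1}^\infty\lambda_{in}<\infty,\quad \sum_{n=1}^\infty\tilde\mu_{in}<\infty,\quad \sum_{n=1}^\infty\tilde\lambda_{in}<\infty,$$ and that there exist $M_i,M_i^*,N_i,N_i^*>0$ ($i=1,\dots,m$) such that $\phi_i(\xi)\le M_i^*\xi$ for all $\xi\ge M_i$ and $\varphi_i(\zeta)\le N_i^*\zeta$ for all $\zeta\ge N_i$. Let $0<\alpha_*<\alpha^*<1$ and $0<\beta_*<\beta^*<1$, and let $\{\alpha_{jn}\}_{n\ge1}\subset[\alpha_*,\alpha^*]$ and $\{\beta_{jn}\}_{n\ge1}\subset[\beta_*,\beta^*]$ for $j=0,1,\dots,m$ be real sequences with $\sum_{j=0}^m\alpha_{jn}=1$ and $\sum_{j=0}^m\beta_{jn}=1$ for all $n$. Let $x_1\in K$ be arbitrary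 and define, for $n\ge1$, $$y_n=\beta_{0n}x_n+\sum_{i=1}^m\beta_{in}I_i^nx_n,\qquad x_{n+1}=\alpha_{0n}x_n+\sum_{i=1}^m\alpha_{in}T_i^ny_n.$$ If at least one of the mappings $T_1,\dots,T_m,I_1,\dots,I_m$ is compact, then the sequence $\{x_n\}$ converges strongly (in norm) to a common fixed point of $\{T_i\}_{i=1}^m$ and $\{I_i\}_{i=1}^m$, i.e. to an element of $F$.
   Context: $F(T)=\{x\in K: Tx=x\}$ denotes the fixed point set of $T:K\to K$, and $T^n$ the $n$-th iterate. $\mathbb{R}^+=[0,\infty)$. A mapping $I:K\to K$ is total asymptotically nonexpansive with sequences $\{\tilde\mu_n\},\{\tilde\lambda_n\}$ and function $\varphi$ if $\tilde\mu_n,\tilde\lambda_n\ge0$, $\tilde\mu_n,\tilde\lambda_n\to0$ as $n\to\infty$, $\varphi:\mathbb{R}^+\to\mathbb{R}^+$ is strictly increasing and continuous with $\varphi(0)=0$, and $\|I^nx-I^ny\|\le\|x-y\|+\tilde\mu_n\varphi(\|x-y\|)+\tilde\lambda_n$ for all $x,y\in K$, $n\ge1$. Given $I:K\to K$, a mapping $T:K\to K$ is total asymptotically $I$-nonexpansive with sequences $\{\mu_n\},\{\lambda_n\}$ and function $\phi$ if $\mu_n,\lambda_n\ge0$, $\mu_n,\lambda_n\to0$, $\phi:\mathbb{R}^+\to\mathbb{R}^+$ is strictly increasing and continuous with $\phi(0)=0$, and $\|T^nx-T^ny\|\le\|I^nx-I^ny\|+\mu_n\phi(\|I^nx-I^ny\|)+\lambda_n$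 for all $x,y\in K$, $n\ge1$. A (continuous, possibly nonlinear) mapping $K\to K$ is compact if it maps bounded subsets of $K$ to relatively compact sets. *)

(* Defs.v *)
From HB Require Import structures.
From mathcomp Require Import all_boot all_order all_algebra.
From mathcomp Require Import all_classical all_reals all_analysis.

Set Implicit Arguments.
Unset Strict Implicit.
Unset Printing Implicit Defensive.

Import Order.TTheory GRing.Theory Num.Theory.
Import numFieldNormedType.Exports.

Local Open Scope classical_set_scope.
Local Open Scope ring_scope.

(* Sequences indexed by n >= 1 are functions on nat whose value at 0 is
   never constrained nor used. A self-map of K is a total function X -> X that
   maps K into K; it is only ever evaluated, iterated, or required to be
   continuous on K. *)

Definition uniformly_convex (R : realType) (X : normedModType R) : Prop :=
  forall eps : R, 0 < eps <= 2 ->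
    exists2 delta : R, 0 < delta &
      forall x y : X, `|x| <= 1 -> `|y| <= 1 -> eps <= `|x - y| ->
        `|2^-1 *: (x + y)| <= 1 - delta.

Definition self_map (T : Type) (K : set T) (f : T -> T) : Prop :=
  forall x, K x -> K (f x).

Definition fixed_points (T : Type) (K : set T) (f : T -> T) : set T :=
  [set x | K x /\ f x = x].

Definition common_fixed_points (T : Type) (K : set T) (m : nat)
    (T_ I_ : 'I_m -> T -> T) : set T :=
  \bigcap_(i in [set: 'I_m])
    (fixed_points K (T_ i) `&` fixed_points K (I_ i)).

Definition gauge (R : realType) (phi : R -> R) : Prop :=
  [/\ forall t, 0 <= t -> 0 <= phi t,
      {in `[0, +oo[ &, {homo phi : s t / s < t}},
      {within `[0, +oo[, continuous phi} &
      phi 0 = 0].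

Definition null_nonneg_sequence (R : realType) (u : nat -> R) : Prop :=
  (forall n, (1 <= n)%N -> 0 <= u n) /\ u @ \oo --> (0 : R).

Definition total_asymptotically_nonexpansive (R : realType)
    (X : normedModType R) (K : set X) (I : X -> X)
    (mu lambda : nat -> R) (phi : R -> R) : Prop :=
  [/\ null_nonneg_sequence mu,
      null_nonneg_sequence lambda,
      gauge phi &
      forall x y n, K x -> K y -> (1 <= n)%N ->
        `|iter n I x - iter n I y| <=
          `|x - y| + mu n * phi `|x - y| + lambda n].

Definition total_asymptotically_I_nonexpansive (R : realType)
    (X : normedModType R) (K : set X) (I T : X -> X)
    (mu lambda : nat -> R) (phi : R -> R) : Prop :=
  [/\ null_nonneg_sequence mu,
      null_nonneg_sequence lambda,
      gauge phi &
      forall x y n, K x -> K y -> (1 <= n)%N ->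
        `|iter n T x - iter n T y| <=
          `|iter n I x - iter n I y|
          + mu n * phi `|iter n I x - iter n I y| + lambda n].

Definition compact_mapping (R : realType) (X : normedModType R)
    (K : set X) (f : X -> X) : Prop :=
  {within K, continuous f} /\
  forall B : set X, B `<=` K -> bounded_set B -> precompact (f @` B).

Definition summable_from1 (R : realType) (u : nat -> R) : Prop :=
  cvgn (fun N => \sum_(1 <= n < N) u n).

(* Main.v *)
Require Import Defs.
From mathcomp Require Import ring lra.
From HB Require Import structures.
From mathcomp Require Import all_boot all_order all_algebra.
From mathcomp Require Import all_classical all_reals all_analysis.

Set Implicit Arguments.
Unset Strict Implicit.
Unset Printing Implicit Defensive.

Import Order.TTheory GRing.Theory Num.Theory.
Import numFieldNormedType.Exports.

Local Open Scope classical_set_scope.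
Local Open Scope ring_scope.

(** The linear growth of the gauges turns the total asymptotic estimates into
    multiplicative ones for [1 + `|u - v|]: all the [n]-th iterates expand it
    by at most [1 + e n] (resp. [(1 + e n) ^+ 2]), where [e] is summable. Hence
    [1 + `|x n - p|] grows by at most [expR (3 * e n)] in one step, and
    [`|x n - p|] converges for every common fixed point [p]. As the weights are
    bounded below, uniform convexity applied first to [x n.+1] and then to [y n]
    gives [T_i^n y_n - x_n -> 0] and [I_i^n x_n - x_n -> 0], so that
    [y_n - x_n -> 0], [x_{n+1} - x_n -> 0] and [T_i^n x_n - x_n -> 0]. For [f]
    any of the maps, [z_n = f^n x_{n+1}] then satisfies [z_n - x_{n+1} -> 0] and
    [f z_n - x_{n+1} -> 0]. If [f] is compact, [f z_n], hence [x_n], has a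
    cluster point [q]; continuity makes [q] a fixed point of every map, and the
    convergent sequence [`|x n - q|] can only tend to [0]. *)

(** * Real sequences: summability, quasi-monotone convergence, growth of gauges *)

Section real_sequences.
Variable R : realType.
Implicit Types a e u v : nat -> R.

Lemma summable_from1D u v :
  summable_from1 u -> summable_from1 v -> summable_from1 (u \+ v).
Proof.
move=> cu cv; rewrite /summable_from1; under eq_fun do rewrite big_split/=.
exact: is_cvgD.
Qed.

Lemma summable_from1Z (c : R) u :
  summable_from1 u -> summable_from1 (fun n => c * u n).
Proof.
move=> cu; rewrite /summable_from1; under eq_fun do rewrite -mulr_sumr.
by apply: is_cvgM => //; exact: is_cvg_cst.
Qed.

Lemma summable_from1_sum (I : finType) (f : I -> nat -> R) :
  (forall i, summable_from1 (f i)) -> summable_from1 (fun n => \sum_i f i n).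
Proof.
move=> cf; rewrite /summable_from1.
have -> : (fun N => \sum_(1 <= n < N) \sum_i f i n) =
    \sum_i (fun N => \sum_(1 <= n < N) f i n).
  by apply/funext => N; rewrite fct_sumE exchange_big.
apply: (big_ind (fun u : nat -> R => cvgn u)) => [|u v cu cv|i _].
- exact: is_cvg_cst.
- exact: is_cvgD.
- exact: cf.
Qed.

Lemma summable_from1_cvg0 u : summable_from1 u -> u @ \oo --> (0 : R).
Proof.
move=> cu; have := cu; rewrite /summable_from1 => /cvg_ex[l sl].
rewrite -cvg_shiftS.
suff: (fun n => u n.+1) @ \oo --> l - l by rewrite subrr.
have -> : (fun n => u n.+1) =
  (fun n => \sum_(1 <= k < n.+2) u k - \sum_(1 <= k < n.+1) u k).
  by apply/funext => n; rewrite big_nat_recr//= addrAC subrr add0r.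
apply: cvgB; last by rewrite (cvg_shiftS (fun n => \sum_(1 <= k < n) u k)).
rewrite (cvg_shiftS (fun n => \sum_(1 <= k < n.+1) u k)).
by rewrite (cvg_shiftS (fun n => \sum_(1 <= k < n) u k)).
Qed.

(** Multiplying [a n] by the exponential of minus the partial sum of [e] gives a nonincreasing
    sequence bounded below by 0. Undoing this multiplies two convergent sequences. *)
Lemma quasi_decreasing_cvg a e :
  (forall n, (1 <= n)%N -> 0 <= a n) ->
  (forall n, (1 <= n)%N -> a n.+1 <= expR (e n) * a n) ->
  summable_from1 e -> cvgn a.
Proof.
move=> a0 ae se; pose s n := \sum_(1 <= k < n) e k.
pose b n := a n.+1 * expR (- s n.+1).
have cb : cvgn b.
  apply: nonincreasing_is_cvgn; last first.
    by exists 0 => _ [n _ <-]; rewrite mulr_ge0 ?expR_ge0 ?a0.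
  apply/nonincreasing_seqP => n; rewrite /b /s big_nat_recr//= opprD expRD.
  rewrite mulrCA mulrC ler_wpM2r ?expR_ge0// expRN ler_pdivrMr ?expR_gt0//.
  by rewrite [leRHS]mulrC ae.
have cs : cvgn (fun n => expR (s n.+1)).
  apply: (cvgP (expR (limn s))).
  apply: (@cvg_comp _ _ _ (fun n => s n.+1) (@expR R) _ (nbhs (limn s))).
    by rewrite (cvg_shiftS s).
  exact: continuous_expR.
have abs : (fun n => a n.+1) = (fun n => b n * expR (s n.+1)).
  by apply/funext => n; rewrite /b -mulrA -expRD addNr expR0 mulr1.
apply: (cvgP (limn b * limn (fun n => expR (s n.+1)))).
by rewrite -cvg_shiftS abs; exact: cvgM.
Qed.

(** Below [M] monotonicity bounds [phi] by the constant [phi M], above [M] the linear growth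
    applies; the sum of both constants covers the two ranges. *)
Lemma gauge_affine_bound (phi : R -> R) (M Mstar : R) : gauge phi ->
  0 < M -> 0 < Mstar -> (forall xi, M <= xi -> phi xi <= Mstar * xi) ->
  exists2 C, 0 <= C & forall t, 0 <= t -> phi t <= C * (1 + t).
Proof.
move=> [phi0 phi_lt _ _] M0 Ms0 phiM.
have pM := phi0 _ (ltW M0).
exists (phi M + Mstar); first by rewrite addr_ge0// ltW.
move=> t t0; have [tM|Mt] := ltP t M.
  have : phi t < phi M.
    by apply: phi_lt => //; rewrite in_itv/= andbT// ltW.
  by nra.
by have := phiM _ Mt; nra.
Qed.

End real_sequences.

(** * Finite convex combinations *)

Section convex_combinations.
Variables (R : realType) (X : normedModType R).

(** Induction on the number of points: the tail, renormalised by its total weight [s], is a point of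
    [K], and the head is joined to it by a two-point combination. Strict positivity of the weights
    makes [s] invertible. *)
Lemma convex_set_sum (K : set X) :
  convex_set (K : set (convex_lmodType X)) ->
  forall m (w : 'I_m.+1 -> R) (u : 'I_m.+1 -> X),
    (forall j, 0 < w j) -> \sum_j w j = 1 -> (forall j, K (u j)) ->
    K (\sum_j w j *: u j).
Proof.
move=> cK; elim=> [|m IHm] w u w0.
  by rewrite !big_ord1 => -> Ku; rewrite scale1r.
rewrite big_ord_recl [in K _]big_ord_recl.
set s := \sum_(i < m.+1) w (lift ord0 i) => ws Ku.
have s0 : 0 < s.
  by rewrite /s big_ord_recl ltr_wpDr// sumr_ge0// => i _; exact: ltW.
have w01 : w ord0 <= 1. by rewrite -ws lerDl ltW.
have Kv : K (\sum_(i < m.+1) (w (lift ord0 i) / s) *: u (lift ord0 i)).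
  apply: IHm => // [j|]; first by rewrite divr_gt0.
  by rewrite -mulr_suml divff// gt_eqF.
have := @cK _ _ (Itv01 (ltW (w0 ord0)) w01) (mem_set (Ku ord0)) (mem_set Kv).
rewrite inE; congr K; congr (_ + _).
rewrite /= /unstable.onem -ws addrC addKr scaler_sumr; apply: eq_bigr => i _.
by rewrite scalerA mulrC divfK// gt_eqF.
Qed.

Lemma sum_scaleB_const (I : finType) (w : I -> R) (u : I -> X) (p : X) :
  \sum_j w j = 1 -> \sum_j w j *: u j - p = \sum_j w j *: (u j - p).
Proof.
move=> w1; rewrite -{1}[p]scale1r -w1 scaler_suml -sumrB.
by apply: eq_bigr => j _; rewrite scalerBr.
Qed.

Lemma norm_sum_scale_le (I : finType) (P : pred I) (w : I -> R) (u : I -> X) r :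
  (forall j, 0 <= w j) -> (forall j, `|u j| <= r) ->
  `|\sum_(j | P j) w j *: u j| <= (\sum_(j | P j) w j) * r.
Proof.
move=> w0 ur; rewrite (le_trans (ler_norm_sum _ _ _))// mulr_suml.
by apply: ler_sum => j _; rewrite normrZ ger0_norm// ler_wpM2l.
Qed.

End convex_combinations.

(** * Uniform convexity on arbitrary balls and for weighted sums *)

Section uniform_convexity.
Variables (R : realType) (X : normedModType R).
Hypothesis hX : uniformly_convex X.

(** Dividing by [r] reduces to the unit ball, so the same [delta] serves all radii. *)
Lemma uniformly_convex_scaled (eps : R) : 0 < eps <= 2 ->
  exists2 delta : R, 0 < delta &
    forall r (x y : X), 0 < r -> `|x| <= r -> `|y| <= r ->
      eps * r <= `|x - y| -> `|x + y| <= 2 * ((1 - delta) * r).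
Proof.
move=> /hX[delta d0 hd]; exists delta => // r x y r0 xr yr xyr.
have nr (v : X) : `|r^-1 *: v| = r^-1 * `|v|.
  by rewrite normrZ gtr0_norm ?invr_gt0.
have := hd (r^-1 *: x) (r^-1 *: y).
rewrite -scalerBr -scalerDr !nr [`|2^-1 *: _|]normrZ nr gtr0_norm ?invr_gt0//.
move=> /(_ _ _ _)/wrap[].
- by rewrite mulrC ler_pdivrMr ?mul1r.
- by rewrite mulrC ler_pdivrMr ?mul1r.
- by rewrite [leRHS]mulrC ler_pdivlMr.
- by rewrite mulrCA ler_pdivrMl// [r * _]mulrC ler_pdivrMl.
Qed.

(* Split off the midpoint of [u j] and [u k] with the weight [2 * a]: if they
   were far apart, the combination would have a norm well below [c]. *)
Lemma uniformly_convex_weighted (c a eta : R) : 0 <= c -> 0 < a -> 0 < eta ->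
  exists2 theta, 0 < theta &
    forall (I : finType) (w : I -> R) (u : I -> X) (j k : I),
      (forall i, a <= w i) -> \sum_i w i = 1 ->
      (forall i, `|u i| <= c + theta) ->
      c - theta <= `|\sum_i w i *: u i| -> `|u j - u k| < eta.
Proof.
(* If [c = 0] there is no radius to exploit, but all points have norm at most [eta / 4], so their
   differences have norm at most [eta / 2]. *)
move=> c0 a0 eta0; move: c0; rewrite le_eqVlt => /predU1P[<-|c0].
  exists (eta / 4); first by lra.
  move=> I w u j k _ _ ur _; rewrite (le_lt_trans (ler_normB _ _))//.
  by have := ur j; have := ur k; lra.
(* As [theta] will be at most 1, the separation [eta / (c + 1)] relative to the radius [c + theta]
   amounts to at most [eta]; the minimum with 2 keeps it in the range of uniform convexity. *)
have [delta d0 hd] : exists2 delta : R, 0 < delta &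
    forall r (x y : X), 0 < r -> `|x| <= r -> `|y| <= r ->
      Num.min 2 (eta / (c + 1)) * r <= `|x - y| ->
      `|x + y| <= 2 * ((1 - delta) * r).
  apply: uniformly_convex_scaled.
  by rewrite lt_min ge_min lexx ltr0n divr_gt0//; lra.
have adc0 : 0 < a * delta * c by rewrite !mulr_gt0.
(* If [u j] and [u k] are far apart, the combination has norm at most
   [(1 - 2 * a * delta) * (c + theta)]. This is below [c - theta] once
   [theta < a * delta * (c + theta)], which the second argument of the minimum ensures. *)
pose theta := Num.min 1 (a * delta * c / 2).
have th0 : 0 < theta by rewrite lt_min ltr01 divr_gt0.
have th1 : theta <= 1 by rewrite ge_min lexx.
have th2 : theta <= a * delta * c / 2 by rewrite ge_min lexx orbT.
exists theta => // I w u j k wa w1 ur cu; rewrite ltNge; apply/negP => etajk.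
have r0 : 0 < c + theta by rewrite addr_gt0.
have w0 i : 0 <= w i by rewrite (le_trans (ltW a0)).
have kj : k != j.
  by apply: contraTneq etajk => ->; rewrite subrr normr0 -ltNge.
have ujk : `|u j + u k| <= 2 * ((1 - delta) * (c + theta)).
  apply: hd => //; apply: le_trans etajk.
  apply: (@le_trans _ _ (eta / (c + 1) * (c + theta))).
    by rewrite ler_wpM2r ?(ltW r0)// ge_min lexx orbT.
  by rewrite mulrAC ler_pdivrMr; nra.
pose P i := (i != j) && (i != k).
have {}w1 : w j + (w k + \sum_(i | P i) w i) = 1.
  by move: w1; rewrite (bigD1 j)//= [X in _ + X](bigD1 k).
pose v := \sum_(i | P i) w i *: u i.
have vr : `|v| <= (\sum_(i | P i) w i) * (c + theta).
  exact: norm_sum_scale_le.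
have sumE : \sum_i w i *: u i =
    a *: (u j + u k) + ((w j - a) *: u j + ((w k - a) *: u k + v)).
  rewrite (bigD1 j)//= [X in _ + X = _](bigD1 k)//= -/v.
  rewrite -[w j in LHS](subrK a) -[w k in LHS](subrK a) !scalerDl scalerDr.
  by rewrite [LHS](AC (2*3) ((2*4)*(1*(3*5)))).
have njr i : `|(w i - a) *: u i| <= (w i - a) * (c + theta).
  by rewrite normrZ ger0_norm ?subr_ge0// ler_wpM2l ?subr_ge0.
have : `|\sum_i w i *: u i| <= `|a *: (u j + u k)| +
    (`|(w j - a) *: u j| + (`|(w k - a) *: u k| + `|v|)).
  rewrite sumE (le_trans (ler_normD _ _))// lerD2l.
  rewrite (le_trans (ler_normD _ _))// lerD2l; exact: ler_normD.
rewrite [`|a *: _|]normrZ (gtr0_norm a0).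
have := ler_wpM2l (ltW a0) ujk.
have w1r : w j * (c + theta) +
    (w k * (c + theta) + (\sum_(i | P i) w i) * (c + theta)) = c + theta.
  by rewrite -!mulrDl w1 mul1r.
have adt0 : 0 < a * delta * theta by rewrite !mulr_gt0.
by have := njr j; have := njr k; lra.
Qed.

End uniform_convexity.

(** * Limits of convex combinations and of iterates of almost nonexpansive maps *)

Section sequences_in_convex_sets.
Variables (R : realType) (X : normedModType R).

(** A version of Schu's lemma for finitely many points: since [r] and [s] have the same limit [c],
    the tolerance [theta] belonging to a given [eta] is eventually met on both sides. *)
Lemma uniformly_convex_cvg (I : finType) (w : I -> nat -> R)
    (u : I -> nat -> X) (r s : nat -> R) (c a : R) (j k : I) :
  uniformly_convex X -> 0 < a ->
  (forall i n, (1 <= n)%N -> a <= w i n) ->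
  (forall n, (1 <= n)%N -> \sum_i w i n = 1) ->
  (forall i n, (1 <= n)%N -> `|u i n| <= r n) ->
  (forall n, (1 <= n)%N -> s n <= `|\sum_i w i n *: u i n|) ->
  r @ \oo --> c -> s @ \oo --> c ->
  (fun n => u j n - u k n) @ \oo --> (0 : X).
Proof.
move=> hX a0 wa w1 ur su rc sc.
have c0 : 0 <= c.
  rewrite -(cvg_lim _ rc)//; apply: limr_ge; first exact: cvgP rc.
  near=> n; rewrite (le_trans (normr_ge0 (u j n)))// ur//.
  by near: n; exact: nbhs_infty_ge.
apply/cvgr0Pnorm_lt => eta eta0.
have [theta th0 hth] := uniformly_convex_weighted hX c0 a0 eta0.
have rth : \forall n \near \oo, r n < c + theta.
  by apply: cvgr_lt rc _ _; rewrite ltrDl.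
have sth : \forall n \near \oo, c - theta < s n.
  by apply: cvgr_gt sc _ _; rewrite ltrBlDr ltrDl.
near=> n; have n1 : (1 <= n)%N by near: n; exact: nbhs_infty_ge.
apply: (hth _ (w^~ n) (u^~ n)) => [i||i|].
- exact: wa.
- exact: w1.
- rewrite (le_trans (ur _ _ n1))// ltW//; near: n; exact: rth.
- rewrite (le_trans _ (su _ n1))// ltW//; near: n; exact: sth.
Unshelve. all: by end_near. Qed.

Lemma convex_combination_cvg (I : finType) (w : I -> nat -> R)
    (u : I -> nat -> X) (v x : nat -> X) :
  (forall i n, (1 <= n)%N -> 0 <= w i n) ->
  (forall n, (1 <= n)%N -> \sum_i w i n = 1) ->
  (forall n, (1 <= n)%N -> v n = \sum_i w i n *: u i n) ->
  (forall i, (fun n => u i n - x n) @ \oo --> (0 : X)) ->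
  (fun n => v n - x n) @ \oo --> (0 : X).
Proof.
move=> w0 w1 vE ux; apply/norm_cvg0P.
(* Each distance is at most the sum of all of them, and the weights add up to 1, so this sum
   dominates the norm of the combination. *)
apply: (@squeeze_cvgr _ _ _ _ (fun=> 0) (\sum_i (fun n => `|u i n - x n|))).
- near=> n; have n1 : (1 <= n)%N by near: n; exact: nbhs_infty_ge.
  rewrite normr_ge0/= vE// sum_scaleB_const ?w1// fct_sumE.
  apply: le_trans (norm_sum_scale_le _ (w0^~ n ^~ n1) _) _; last first.
    by rewrite w1// mul1r.
  by move=> j; rewrite (bigD1 j)//= lerDl sumr_ge0.
- exact: cvg_cst.
- apply: (big_ind (fun a : nat -> R => a @ \oo --> (0 : R)))
    => [|a b a0 b0|i _].
  + exact: cvg_cst.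
  + suff : (a + b) @ \oo --> 0 + (0 : R) by rewrite addr0.
    exact: cvgD.
  + by apply/norm_cvg0P.
Unshelve. all: by end_near. Qed.

(** Adding 1 to the distances lets a single factor [L n] absorb additive errors as well. *)
Definition almost_nonexpansive (K : set X) (f : X -> X) (L : nat -> R) : Prop :=
  forall n x y, (1 <= n)%N -> K x -> K y ->
    1 + `|iter n f x - iter n f y| <= L n * (1 + `|x - y|).

Lemma almost_nonexpansive_iter_cvg (K : set X) (f : X -> X) L (u v : nat -> X) :
  almost_nonexpansive K f L -> L @ \oo --> (1 : R) ->
  (forall n, (1 <= n)%N -> K (u n)) -> (forall n, (1 <= n)%N -> K (v n)) ->
  (fun n => u n - v n) @ \oo --> (0 : X) ->
  (fun n => iter n f (u n) - iter n f (v n)) @ \oo --> (0 : X).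
Proof.
move=> fL L1 Ku Kv uv; apply/norm_cvg0P.
apply: (@squeeze_cvgr _ _ _ _ (fun=> 0)
  (fun n => L n * (1 + `|u n - v n|) - 1)).
- near=> n; have n1 : (1 <= n)%N by near: n; exact: nbhs_infty_ge.
  by rewrite normr_ge0/= lerBrDl fL//; [exact: Ku|exact: Kv].
- exact: cvg_cst.
- suff : (fun n => L n * (1 + `|u n - v n|) - 1) @ \oo -->
      1 * (1 + 0) - (1 : R).
    by rewrite addr0 mul1r subrr.
  apply: cvgB; last exact: cvg_cst.
  apply: cvgM => //; apply: cvgD; first exact: cvg_cst.
  by apply/norm_cvg0P.
Unshelve. all: by end_near. Qed.

Lemma iter_self_map (K : set X) (f : X -> X) n x :
  self_map K f -> K x -> K (iter n f x).
Proof. by move=> Kf Kx; elim: n => //= n; exact: Kf. Qed.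

(** Provides points [z n = iter n f (x n.+1)] such that both [z n] and [f (z n)] stay close to
    [x n.+1]: the first by comparison with [iter n f (x n)], the second because [f (z n)] is
    [iter n.+1 f (x n.+1)], a shift of the hypothesis. *)
Lemma shifted_orbit_cvg (K : set X) (f : X -> X) L (x : nat -> X) :
  almost_nonexpansive K f L -> L @ \oo --> (1 : R) ->
  (forall n, (1 <= n)%N -> K (x n)) ->
  (fun n => x n.+1 - x n) @ \oo --> (0 : X) ->
  (fun n => iter n f (x n) - x n) @ \oo --> (0 : X) ->
  (fun n => iter n f (x n.+1) - x n.+1) @ \oo --> (0 : X) /\
  (fun n => f (iter n f (x n.+1)) - x n.+1) @ \oo --> (0 : X).
Proof.
move=> fL L1 Kx xx fx; split; last first.
  by rewrite (cvg_shiftS (fun n => iter n f (x n) - x n)).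
have -> : (fun n => iter n f (x n.+1) - x n.+1) = (fun n =>
    (iter n f (x n.+1) - iter n f (x n)) + (iter n f (x n) - x n)
      - (x n.+1 - x n)).
  by apply/funext => n; rewrite subrKA opprB addrA subrK.
suff : (fun n => (iter n f (x n.+1) - iter n f (x n)) + (iter n f (x n) - x n)
      - (x n.+1 - x n)) @ \oo --> 0 + 0 - (0 : X) by rewrite addr0 subr0.
apply: cvgB => //; apply: cvgD => //.
exact: almost_nonexpansive_iter_cvg fL L1 (fun n _ => Kx n.+1 isT) Kx xx.
Qed.

(** * Cluster points and approximate fixed points *)

Lemma cluster_seqP (u : nat -> X) (q : X) :
  cluster (u @ \oo) q <->
  forall e, 0 < e -> forall N, exists2 n, (N <= n)%N & `|u n - q| < e.
Proof.
split => [uq e e0 N|uq A B [N _ NA] /nbhs_ballP[e /= e0 eB]].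
  have /= : (u @ \oo) (u @` [set n | (N <= n)%N]).
    by exists N => // n Nn; exists n.
  move=> /uq/(_ (nbhsx_ballx q _ e0))[_ [[n Nn <-]]].
  by rewrite -ball_normE/= distrC => ?; exists n.
have [n Nn nq] := uq _ e0 N.
by exists (u n); split; [exact: NA|apply: eB; rewrite -ball_normE/= distrC].
Qed.

Lemma cluster_seqB (u v : nat -> X) (q : X) :
  (fun n => u n - v n) @ \oo --> (0 : X) ->
  cluster (u @ \oo) q -> cluster (v @ \oo) q.
Proof.
move=> /cvgr0Pnorm_lt uv /cluster_seqP uq; apply/cluster_seqP => e e0 N.
have e20 : 0 < e / 2 by rewrite divr_gt0.
have [M _ MN] := uv _ e20.
have [n] := uq _ e20 (maxn M N); rewrite geq_max => /andP[Mn Nn] nq.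
exists n => //; have /= := MN _ Mn; rewrite distrC => vn.
have := ler_distD (u n) (v n) q; lra.
Qed.

(** The sequence [z] is bounded, being close to [x], so compactness gives [f (z n)] a cluster point,
    which [x] inherits. *)
Lemma approximate_fixed_point_cluster (K : set X) (f : X -> X)
    (x z : nat -> X) :
  closed K -> compact_mapping K f -> (exists M, forall n, `|x n| <= M) ->
  (forall n, K (z n)) -> self_map K f ->
  (fun n => z n - x n) @ \oo --> (0 : X) ->
  (fun n => f (z n) - x n) @ \oo --> (0 : X) ->
  exists2 q, K q & cluster (x @ \oo) q.
Proof.
move=> Kcl [_ cf] [M xM] Kz Kf zx fzx.
have zK : range z `<=` K by move=> _ [n _ <-].
have zb : bounded_set (range z).
  have [M' [_ HM']] := cvg_seq_bounded (cvgP _ zx).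
  (* Boundedness is stated for every bound strictly above [M'], hence the [+ 1]. *)
  have {}HM' := HM' (M' + 1) (ltr_pwDr ltr01 (lexx _)).
  exists (M + (M' + 1)); split; first by rewrite num_real.
  move=> t /ltW Mt _ [n _ <-] /=; apply: le_trans Mt.
  rewrite -(subrK (x n) (z n)) addrC (le_trans (ler_normD _ _))// lerD//.
  exact: HM'.
have := cf _ zK zb; rewrite precompactE => /(_ ((f \o z) @ \oo) _)[].
  by exists 0%N => // n _; apply: subset_closure; exists (z n).
move=> q [clq fq]; exists q.
  rewrite (closure_id K).1//; apply: closure_subset clq => _ [_ [n _ <-] <-].
  exact: Kf.
exact: cluster_seqB fzx fq.
Qed.

Lemma cluster_approximate_fixed_point (K : set X) (f : X -> X)
    (x z : nat -> X) (q : X) :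
  {within K, continuous f} -> K q -> cluster (x @ \oo) q ->
  (forall n, K (z n)) ->
  (fun n => z n - x n) @ \oo --> (0 : X) ->
  (fun n => f (z n) - x n) @ \oo --> (0 : X) ->
  f q = q.
Proof.
move=> /subspace_continuousP cf Kq /cluster_seqP xq Kz.
move=> /cvgr0Pnorm_lt zx /cvgr0Pnorm_lt fzx.
apply/eqP; rewrite -subr_eq0 -normr_le0; apply/ler_addgt0Pr => e e0.
rewrite add0r.
have e30 : 0 < e / 3 by rewrite divr_gt0.
have /cvgrPdist_lt/(_ _ e30) := cf q Kq.
rewrite near_withinE => /nbhs_ballP[d /= d0 dq].
have [N1 _ HN1] := zx _ (divr_gt0 d0 (ltr0n _ 2)).
have [N2 _ HN2] := fzx _ e30.
(* With [x n] within [d / 2] of [q], the point [z n] enters the ball of radius [d] where continuity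
   applies; [e / 3] is the last share in the path from [f q] through [f (z n)] and [x n] to [q]. *)
have d'0 : 0 < Num.min (d / 2) (e / 3) by rewrite lt_min e30 divr_gt0.
have [n] := xq _ d'0 (maxn N1 N2).
rewrite geq_max lt_min => /andP[/HN1/= zn /HN2/= fzn] /andP[xd xe].
have zd : `|q - z n| < d.
  by have := ler_distD (x n) (z n) q; rewrite [`|z n - q|]distrC; lra.
have /= := dq (z n); rewrite -ball_normE/= => /(_ zd (Kz n)) fqz.
have := ler_distD (f (z n)) (f q) q; have := ler_distD (x n) (f (z n)) q.
lra.
Qed.

(** The norms are arbitrarily small at arbitrarily late indices, so their limit is 0. *)
Lemma cluster_norm_cvg (x : nat -> X) (q : X) :
  cluster (x @ \oo) q -> cvgn (fun n => `|x n - q|) -> x @ \oo --> q.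
Proof.
move=> /cluster_seqP xq /cvg_ex[l xl].
suff l0 : l = 0.
  apply/subr_cvg0/norm_cvg0P; rewrite -l0; exact: xl.
apply/eqP; rewrite -normr_le0; apply/ler_addgt0Pr => e e0; rewrite add0r.
have e20 : 0 < e / 2 by rewrite divr_gt0.
have /cvgrPdist_lt/(_ _ e20)[N _ HN] := xl.
have [n Nn nq] := xq _ e20 N.
have /= := HN n Nn.
have := ler_normD (l - `|x n - q|) `|x n - q|; rewrite subrK normr_id; lra.
Qed.

End sequences_in_convex_sets.

(** Both errors are at most multiples of [1 + d]: [mu * phi d] with coefficient [C * mu], and [la]
    with coefficient [la]. *)
Lemma total_bound_affine (R : realType) (phi : R -> R) (d d' mu la C e : R) :
  0 <= d -> 0 <= mu -> 0 <= la -> phi d <= C * (1 + d) ->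
  d' <= d + mu * phi d + la -> C * mu + la <= e ->
  1 + d' <= (1 + e) * (1 + d).
Proof.
move=> d0 mu0 la0 phid d'd he.
have h1 := ler_wpM2l mu0 phid.
have h2 : (C * mu + la) * (1 + d) <= e * (1 + d) by rewrite ler_wpM2r; lra.
have h3 : 0 <= la * d by exact: mulr_ge0.
lra.
Qed.

(** * The iteration under multiplicative bounds with one error sequence [e] *)

Section iteration.
Variables (R : realType) (X : normedModType R) (K : set X).
Hypotheses (hX : uniformly_convex X) (K_closed : closed K).
Hypothesis K_convex : convex_set (K : set (convex_lmodType X)).
Variables (m : nat) (I_ T_ : 'I_m -> X -> X) (e : nat -> R).
Hypotheses (I_self : forall i, self_map K (I_ i))
  (T_self : forall i, self_map K (T_ i)).
Hypothesis e_ge0 : forall n, (1 <= n)%N -> 0 <= e n.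
Hypothesis e_sum : summable_from1 e.
Hypothesis I_bound : forall i n x y, (1 <= n)%N -> K x -> K y ->
  1 + `|iter n (I_ i) x - iter n (I_ i) y| <= (1 + e n) * (1 + `|x - y|).
Hypothesis T_bound : forall i n x y, (1 <= n)%N -> K x -> K y ->
  1 + `|iter n (T_ i) x - iter n (T_ i) y| <=
    (1 + e n) * (1 + `|iter n (I_ i) x - iter n (I_ i) y|).
Variables (a b : R) (alpha beta : 'I_m.+1 -> nat -> R).
Hypotheses (a_gt0 : 0 < a) (b_gt0 : 0 < b).
Hypotheses (alpha_ge : forall j n, (1 <= n)%N -> a <= alpha j n)
  (beta_ge : forall j n, (1 <= n)%N -> b <= beta j n).
Hypotheses
  (alpha_sum : forall n, (1 <= n)%N -> \sum_(j < m.+1) alpha j n = 1)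
  (beta_sum : forall n, (1 <= n)%N -> \sum_(j < m.+1) beta j n = 1).
Variables (x y : nat -> X).
Hypothesis x1_in_K : K (x 1%N).

(* The points averaged at step [n] are indexed by ['I_m.+1]: the head is [x n],
   the tail consists of the [m] iterates. *)
Definition with_head (h : X) (t : 'I_m -> X) (j : 'I_m.+1) : X :=
  oapp t h (unlift ord0 j).

Lemma sum_with_head (w : 'I_m.+1 -> R) h t :
  w ord0 *: h + \sum_(i < m) w (lift ord0 i) *: t i =
  \sum_j w j *: with_head h t j.
Proof.
rewrite big_ord_recl /with_head unlift_none/=; congr (_ + _).
by apply: eq_bigr => i _; rewrite liftK.
Qed.

Lemma with_headP (P : X -> Prop) h t :
  P h -> (forall i, P (t i)) -> forall j, P (with_head h t j).
Proof. by move=> Ph Pt j; rewrite /with_head; case: unlift => /=. Qed.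

Let Ix j n := with_head (x n) (fun i => iter n (I_ i) (x n)) j.
Let Ty j n := with_head (x n) (fun i => iter n (T_ i) (y n)) j.

Hypothesis y_def : forall n, (1 <= n)%N -> y n = \sum_j beta j n *: Ix j n.
Hypothesis x_def : forall n, (1 <= n)%N -> x n.+1 = \sum_j alpha j n *: Ty j n.

Let alpha_gt0 j n : (1 <= n)%N -> 0 < alpha j n.
Proof. by move=> n1; rewrite (lt_le_trans a_gt0)// alpha_ge. Qed.

Let beta_gt0 j n : (1 <= n)%N -> 0 < beta j n.
Proof. by move=> n1; rewrite (lt_le_trans b_gt0)// beta_ge. Qed.

Let y_in_K n : (1 <= n)%N -> K (x n) -> K (y n).
Proof.
move=> n1 Kx; rewrite y_def//; apply: convex_set_sum => // [j||].
- exact: beta_gt0.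
- exact: beta_sum.
- by apply: with_headP => // i; exact: iter_self_map.
Qed.

Lemma iterates_in_K n : (1 <= n)%N -> K (x n).
Proof.
(* The induction starts at index 1, as [x 0] is unconstrained. *)
case: n => // n _; elim: n => // n Kx.
rewrite x_def//; apply: convex_set_sum => // [j||].
- exact: alpha_gt0.
- exact: alpha_sum.
- by apply: with_headP => // i; apply: iter_self_map => //; exact: y_in_K.
Qed.

Let e_cvg0 : e @ \oo --> (0 : R).
Proof. exact: summable_from1_cvg0. Qed.

Let factor_cvg1 : (fun n => 1 + e n) @ \oo --> (1 : R).
Proof.
suff : (fun n => 1 + e n) @ \oo --> 1 + (0 : R) by rewrite addr0.
by apply: cvgD => //; exact: cvg_cst.
Qed.

Let factor2_cvg1 : (fun n => (1 + e n) ^+ 2) @ \oo --> (1 : R).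
Proof.
suff : (fun n => (1 + e n) * (1 + e n)) @ \oo --> 1 * (1 : R).
  by rewrite mulr1; under eq_fun do rewrite -expr2.
exact: cvgM.
Qed.

Lemma I_almost_nonexpansive i :
  almost_nonexpansive K (I_ i) (fun n => 1 + e n).
Proof. by move=> n u v; exact: I_bound. Qed.

Lemma T_almost_nonexpansive i :
  almost_nonexpansive K (T_ i) (fun n => (1 + e n) ^+ 2).
Proof.
move=> n u v n1 Ku Kv; rewrite (le_trans (T_bound i n1 Ku Kv))// expr2 -mulrA.
by rewrite ler_wpM2l ?I_bound// addr_ge0// e_ge0.
Qed.

(** * Asymptotics relative to one common fixed point [p] *)

Section common_fixed_point.
Variable p : X.
Hypothesis p_fixed : common_fixed_points K T_ I_ p.
Hypothesis m_gt0 : (0 < m)%N.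

Let i0 := Ordinal m_gt0.

(** An index is required here: over an empty family the intersection would be the whole space. *)
Let Kp : K p.
Proof. by have /(_ i0 Logic.I)[[]] := p_fixed. Qed.

Let iterT_p i n : iter n (T_ i) p = p.
Proof. by have /(_ i Logic.I)[[_ Tp] _] := p_fixed; elim: n => //= n ->. Qed.

Let iterI_p i n : iter n (I_ i) p = p.
Proof. by have /(_ i Logic.I)[_ [_ Ip]] := p_fixed; elim: n => //= n ->. Qed.

Let d n := 1 + `|x n - p|.

Let d_ge1 n : 1 <= d n.
Proof. by rewrite lerDl. Qed.

Let Ix_le n j : (1 <= n)%N -> `|Ix j n - p| <= (1 + e n) * d n - 1.
Proof.
move=> n1; have en := e_ge0 n1.
apply: (with_headP (P := fun v => `|v - p| <= (1 + e n) * d n - 1)) => [|i].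
  by have := d_ge1 n; rewrite /d; nra.
rewrite lerBrDl; have := I_bound i n1 (iterates_in_K n1) Kp.
by rewrite iterI_p.
Qed.

Let y_le n : (1 <= n)%N -> 1 + `|y n - p| <= (1 + e n) * d n.
Proof.
move=> n1; rewrite y_def// sum_scaleB_const ?beta_sum// -lerBrDl.
apply: le_trans (norm_sum_scale_le _ _ (fun j => Ix_le j n1)) _ => [j|].
  by rewrite ltW ?beta_gt0.
by rewrite beta_sum// mul1r.
Qed.

Let Ty_le_y n i : (1 <= n)%N ->
  1 + `|iter n (T_ i) (y n) - p| <= (1 + e n) ^+ 2 * (1 + `|y n - p|).
Proof.
move=> n1; have Kyn := y_in_K n1 (iterates_in_K n1).
by have := T_almost_nonexpansive i n1 Kyn Kp; rewrite iterT_p.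
Qed.

Let Ty_le n j : (1 <= n)%N -> `|Ty j n - p| <= (1 + e n) ^+ 3 * d n - 1.
Proof.
move=> n1; have en := e_ge0 n1.
apply: (with_headP (P := fun v => `|v - p| <= (1 + e n) ^+ 3 * d n - 1))
  => [|i].
  rewrite lerBrDl -/(d n) -[leLHS]mul1r ler_wpM2r//.
    by rewrite (le_trans ler01).
  by rewrite exprn_ege1// lerDl.
rewrite lerBrDl (le_trans (Ty_le_y i n1))// [_ ^+ 3]exprSr -mulrA.
rewrite ler_wpM2l ?y_le//.
by rewrite exprn_ge0// addr_ge0.
Qed.

Lemma norm_iterates_cvg : cvgn (fun n => `|x n - p|).
Proof.
suff /cvg_ex[l dl] : cvgn d.
  apply/cvg_ex; exists (l - 1).
  have -> : (fun n => `|x n - p|) = (fun n => d n - 1).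
    by apply/funext => n; rewrite /d [RHS]addrC addKr.
  by apply: cvgB => //; exact: cvg_cst.
(* Passing to [y n] costs one factor [1 + e n], the iterate of [T_ i] two more; each is at most
   [expR (e n)]. *)
apply: (@quasi_decreasing_cvg _ _ (fun n => 3 * e n)) => [n _|n n1|].
- exact: le_trans (d_ge1 n).
- rewrite expRM_natl.
  apply: (@le_trans _ _ ((1 + e n) ^+ 3 * d n)).
    rewrite /d -lerBrDl x_def// sum_scaleB_const ?alpha_sum//.
    apply: le_trans (norm_sum_scale_le _ _ (fun j => Ty_le j n1)) _ => [j|].
      by rewrite ltW ?alpha_gt0.
    by rewrite alpha_sum// mul1r.
  rewrite ler_wpM2r ?(le_trans ler01)// lerXn2r ?nnegrE ?expR_ge0 ?expR_ge1Dx//.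
  by rewrite addr_ge0// e_ge0.
- exact: summable_from1Z.
Qed.

Let d_cvg : cvgn d.
Proof. by apply: is_cvgD; [exact: is_cvg_cst|exact: norm_iterates_cvg].
Qed.

(** The points [Ty j n - p] have norms at most [r n], and their combination [x n.+1 - p] has norm
    [d n.+1 - 1]; both bounds tend to [l - 1], so uniform convexity brings each tail point close to
    the head [x n]. *)
Lemma Ty_sub_x_cvg i :
  (fun n => iter n (T_ i) (y n) - x n) @ \oo --> (0 : X).
Proof.
have /cvg_ex[l dl] := d_cvg.
have : (fun n => (Ty (lift ord0 i) n - p) - (Ty ord0 n - p)) @ \oo --> (0 : X).
  apply: (uniformly_convex_cvg (c := l - 1) (u := fun j n => Ty j n - p)
    (r := fun n => (1 + e n) ^+ 3 * d n - 1)
    (s := fun n => d n.+1 - 1) (lift ord0 i) ord0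
    hX a_gt0 alpha_ge alpha_sum _ _ _ _).
  - by move=> j n n1; exact: Ty_le.
  - move=> n n1.
    rewrite -sum_scaleB_const ?alpha_sum// -x_def// /d.
    by rewrite [leLHS]addrC addKr.
  - suff : (fun n => (1 + e n) ^+ 3 * d n - 1) @ \oo --> 1 * 1 * l - 1.
      by rewrite !mul1r.
    apply: cvgB; last exact: cvg_cst.
    by apply: cvgM => //; under eq_fun do rewrite exprSr; exact: cvgM.
  - by apply: cvgB; [rewrite (cvg_shiftS d)|exact: cvg_cst].
rewrite /Ty /with_head unlift_none liftK/=.
by under eq_fun do rewrite opprB addrA subrK.
Qed.

(** The same argument for [y n]. Its distance to [p] is bounded below through [iter n (T_ i) (y n)],
    which is close to [x n] and expands that distance by a factor tending to 1, up to the shift by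
    1. *)
Lemma Ix_sub_x_cvg i :
  (fun n => iter n (I_ i) (x n) - x n) @ \oo --> (0 : X).
Proof.
have /cvg_ex[l dl] := d_cvg.
have : (fun n => (Ix (lift ord0 i) n - p) - (Ix ord0 n - p)) @ \oo --> (0 : X).
  apply: (uniformly_convex_cvg (c := l - 1) (u := fun j n => Ix j n - p)
    (r := fun n => (1 + e n) * d n - 1)
    (s := fun n => ((1 + e n) ^+ 2)^-1 *
                   (d n - `|iter n (T_ i) (y n) - x n|) - 1)
    (lift ord0 i) ord0 hX b_gt0 beta_ge beta_sum _ _ _ _).
  - by move=> j n n1; exact: Ix_le.
  - move=> n n1; have en := e_ge0 n1.
    have e2 : 0 < (1 + e n) ^+ 2 by rewrite exprn_gt0//; lra.
    rewrite -sum_scaleB_const ?beta_sum// -y_def// lerBlDl ler_pdivrMl//.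
    apply: le_trans (Ty_le_y i n1); rewrite /d.
    have := ler_distD (iter n (T_ i) (y n)) (x n) p.
    by rewrite [`|x n - iter _ _ _|]distrC; lra.
  - suff : (fun n => (1 + e n) * d n - 1) @ \oo --> 1 * l - 1 by rewrite mul1r.
    by apply: cvgB; [exact: cvgM|exact: cvg_cst].
  - suff : (fun n => ((1 + e n) ^+ 2)^-1 *
                   (d n - `|iter n (T_ i) (y n) - x n|) - 1) @ \oo -->
        1^-1 * (l - 0) - 1 by rewrite invr1 mul1r subr0.
    apply: cvgB; last exact: cvg_cst.
    apply: cvgM; first by apply: cvgV => //; exact: oner_neq0.
    by apply: cvgB => //; apply/norm_cvg0P; exact: Ty_sub_x_cvg.
rewrite /Ix /with_head unlift_none liftK/=.
by under eq_fun do rewrite opprB addrA subrK.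
Qed.

Let with_head_cvg (t : nat -> 'I_m -> X) :
  (forall i, (fun n => t n i - x n) @ \oo --> (0 : X)) ->
  forall j, (fun n => with_head (x n) (t n) j - x n) @ \oo --> (0 : X).
Proof.
move=> tx j; rewrite /with_head; case: unlift => /= [i|]; first exact: tx.
by under eq_fun do rewrite subrr; exact: cvg_cst.
Qed.

Lemma xS_sub_x_cvg : (fun n => x n.+1 - x n) @ \oo --> (0 : X).
Proof.
apply: (convex_combination_cvg _ alpha_sum x_def) => [j n n1|].
  by rewrite ltW ?alpha_gt0.
by apply: with_head_cvg; exact: Ty_sub_x_cvg.
Qed.

Lemma y_sub_x_cvg : (fun n => y n - x n) @ \oo --> (0 : X).
Proof.
apply: (convex_combination_cvg _ beta_sum y_def) => [j n n1|].
  by rewrite ltW ?beta_gt0.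
by apply: with_head_cvg; exact: Ix_sub_x_cvg.
Qed.

(** Replacing [y n] by [x n] is harmless, since [y n - x n] vanishes and [T_ i] is almost
    nonexpansive. *)
Lemma Tx_sub_x_cvg i :
  (fun n => iter n (T_ i) (x n) - x n) @ \oo --> (0 : X).
Proof.
have -> : (fun n => iter n (T_ i) (x n) - x n) = (fun n =>
    (iter n (T_ i) (x n) - iter n (T_ i) (y n)) + (iter n (T_ i) (y n) - x n)).
  by apply/funext => n; rewrite subrKA.
suff : (fun n => (iter n (T_ i) (x n) - iter n (T_ i) (y n)) +
  (iter n (T_ i) (y n) - x n)) @ \oo --> 0 + (0 : X) by rewrite addr0.
apply: cvgD; last exact: Ty_sub_x_cvg.
apply: almost_nonexpansive_iter_cvg (@T_almost_nonexpansive i) _ _ _ _ => //.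
- exact: iterates_in_K.
- by move=> n n1; apply: y_in_K => //; exact: iterates_in_K.
- suff : (fun n => - (y n - x n)) @ \oo --> - (0 : X).
    by rewrite oppr0; under eq_fun do rewrite opprB.
  by apply: cvgN; exact: y_sub_x_cvg.
Qed.

Lemma shifted_iterates_bounded : exists M, forall n, `|x n.+1| <= M.
Proof.
have [M [_ HM]] := cvg_seq_bounded norm_iterates_cvg.
have {}HM := HM (M + 1) (ltr_pwDr ltr01 (lexx _)).
exists (M + 1 + `|p|) => n.
rewrite -{1}(subrK p (x n.+1)) (le_trans (ler_normD _ _))// lerD2r.
by have /= := HM n.+1 Logic.I; rewrite normr_id.
Qed.

Let TI_family (f : X -> X) := exists i, f = T_ i \/ f = I_ i.

Lemma family_orbit_cvg f : TI_family f ->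
  [/\ self_map K f,
      (fun n => iter n f (x n.+1) - x n.+1) @ \oo --> (0 : X) &
      (fun n => f (iter n f (x n.+1)) - x n.+1) @ \oo --> (0 : X)].
Proof.
move=> [i [->|->]].
- have [? ?] := shifted_orbit_cvg (@T_almost_nonexpansive i) factor2_cvg1
    iterates_in_K xS_sub_x_cvg (Tx_sub_x_cvg i).
  by split.
- have [? ?] := shifted_orbit_cvg (@I_almost_nonexpansive i) factor_cvg1
    iterates_in_K xS_sub_x_cvg (Ix_sub_x_cvg i).
  by split.
Qed.

Lemma family_cluster_common_fixed :
  (forall i, {within K, continuous (T_ i)}) ->
  (forall i, {within K, continuous (I_ i)}) ->
  (exists i, compact_mapping K (T_ i) \/ compact_mapping K (I_ i)) ->
  exists2 q, common_fixed_points K T_ I_ q &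
    cluster ((fun n => x n.+1) @ \oo) q.
Proof.
move=> cT cI compactTI.
have [f Ff compactf] : exists2 f, TI_family f & compact_mapping K f.
  move: compactTI => [i [c|c]]; [exists (T_ i)|exists (I_ i)] => //.
    by exists i; left.
  by exists i; right.
(* The shift to [x n.+1] puts every term in [K], including the one at [n = 0]. *)
have Kz g n : self_map K g -> K (iter n g (x n.+1)).
  by move=> Kg; apply: iter_self_map => //; exact: iterates_in_K.
have [Kf fx1 fx2] := family_orbit_cvg Ff.
have [q Kq xq] := approximate_fixed_point_cluster K_closed compactf
  shifted_iterates_bounded (fun n => Kz f n Kf) Kf fx1 fx2.
exists q => // i _.
(* Each map [g] has its own approximating orbit, but all of them follow [x], so the same [q] serves
   for all. *)
have fixq g : TI_family g -> {within K, continuous g} -> g q = q.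
  move=> Fg cg; have [Kg gx1 gx2] := family_orbit_cvg Fg.
  exact: cluster_approximate_fixed_point cg Kq xq (fun n => Kz g n Kg) gx1 gx2.
split; split => //; apply: fixq => //.
  by exists i; left.
by exists i; right.
Qed.

End common_fixed_point.

Lemma iterates_cvg_common_fixed_point :
  (0 < m)%N -> common_fixed_points K T_ I_ !=set0 ->
  (forall i, {within K, continuous (T_ i)}) ->
  (forall i, {within K, continuous (I_ i)}) ->
  (exists i, compact_mapping K (T_ i) \/ compact_mapping K (I_ i)) ->
  exists2 q, common_fixed_points K T_ I_ q & x @ \oo --> q.
Proof.
move=> m0 [p Fp] cT cI compactTI.
have [q Fq xq] := family_cluster_common_fixed Fp m0 cT cI compactTI.
exists q => //; rewrite -cvg_shiftS; apply: cluster_norm_cvg => //.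
(* The limit of the distances is now used with [q] in place of [p]. *)
have /cvg_ex[l xl] := norm_iterates_cvg Fq m0; apply/cvg_ex; exists l.
by rewrite (cvg_shiftS (fun n => `|x n - q|)).
Qed.

End iteration.

(** * Reduction of the total asymptotic hypotheses to multiplicative bounds *)

Theorem theorem3p7 (R : realType) (X : completeNormedModType R)
  (hX : uniformly_convex X)
  (K : set X) (K_nonempty : K !=set0) (K_closed : closed K)
  (K_convex : convex_set (K : set (convex_lmodType X)))
  (m : nat) (hm : (1 <= m)%N)
  (I_ T_ : 'I_m -> X -> X)
  (mut lambdat mu lambda : 'I_m -> nat -> R) (vphi phi : 'I_m -> R -> R)
  (I_self : forall i, self_map K (I_ i))
  (I_cont : forall i, {within K, continuous (I_ i)})
  (I_tan : forall i,
    total_asymptotically_nonexpansive K (I_ i) (mut i) (lambdat i) (vphi i))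
  (T_self : forall i, self_map K (T_ i))
  (T_cont : forall i, {within K, continuous (T_ i)})
  (T_tan : forall i,
    total_asymptotically_I_nonexpansive K (I_ i) (T_ i)
      (mu i) (lambda i) (phi i))
  (F_nonempty : common_fixed_points K T_ I_ !=set0)
  (mu_sum : forall i, summable_from1 (mu i))
  (lambda_sum : forall i, summable_from1 (lambda i))
  (mut_sum : forall i, summable_from1 (mut i))
  (lambdat_sum : forall i, summable_from1 (lambdat i))
  (phi_linear : exists M Mstar N Nstar : 'I_m -> R, forall i,
    [/\ [/\ 0 < M i, 0 < Mstar i, 0 < N i & 0 < Nstar i],
        forall xi, M i <= xi -> phi i xi <= Mstar i * xi &
        forall zeta, N i <= zeta -> vphi i zeta <= Nstar i * zeta])
  (alpha_lo alpha_hi beta_lo beta_hi : R)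
  (h_alpha : [/\ 0 < alpha_lo, alpha_lo < alpha_hi & alpha_hi < 1])
  (h_beta : [/\ 0 < beta_lo, beta_lo < beta_hi & beta_hi < 1])
  (alpha beta : 'I_m.+1 -> nat -> R)
  (alpha_range : forall j n, (1 <= n)%N -> alpha_lo <= alpha j n <= alpha_hi)
  (beta_range : forall j n, (1 <= n)%N -> beta_lo <= beta j n <= beta_hi)
  (alpha_sum : forall n, (1 <= n)%N -> \sum_(j < m.+1) alpha j n = 1)
  (beta_sum : forall n, (1 <= n)%N -> \sum_(j < m.+1) beta j n = 1)
  (x y : nat -> X) (x1_in_K : K (x 1%N))
  (y_def : forall n, (1 <= n)%N ->
    y n = beta ord0 n *: x n
          + \sum_(i < m) beta (lift ord0 i) n *: iter n (I_ i) (x n))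
  (x_def : forall n, (1 <= n)%N ->
    x n.+1 = alpha ord0 n *: x n
             + \sum_(i < m) alpha (lift ord0 i) n *: iter n (T_ i) (y n))
  (h_compact : exists i,
    compact_mapping K (T_ i) \/ compact_mapping K (I_ i)) :
  exists2 q : X, common_fixed_points K T_ I_ q & x @ \oo --> q.
Proof.
have [M [Ms [N [Ns hMN]]]] := phi_linear.
have /choice[C hC] i : exists C,
    0 <= C /\ forall t, 0 <= t -> vphi i t <= C * (1 + t).
  have [[_ _ N0 Ns0] _ hN] := hMN i; have [_ _ g _] := I_tan i.
  by have [C C0 HC] := gauge_affine_bound g N0 Ns0 hN; exists C.
have /choice[D hD] i : exists D,
    0 <= D /\ forall t, 0 <= t -> phi i t <= D * (1 + t).
  have [[M0 Ms0 _ _] hM _] := hMN i; have [_ _ g _] := T_tan i.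
  by have [D D0 HD] := gauge_affine_bound g M0 Ms0 hM; exists D.
(* These are the coefficients of [total_bound_affine]; summing them over all maps gives one summable
   sequence dominating each. *)
pose eI i n := C i * mut i n + lambdat i n.
pose eT i n := D i * mu i n + lambda i n.
pose e n := \sum_i (eI i n + eT i n).
have eI0 i n : (1 <= n)%N -> 0 <= eI i n.
  move=> n1; have [[mut0 _] [la0 _] _ _] := I_tan i.
  by rewrite addr_ge0 ?la0// mulr_ge0 ?mut0//; case: (hC i).
have eT0 i n : (1 <= n)%N -> 0 <= eT i n.
  move=> n1; have [[mu0 _] [la0 _] _ _] := T_tan i.
  by rewrite addr_ge0 ?la0// mulr_ge0 ?mu0//; case: (hD i).
have eIT i n : (1 <= n)%N -> eI i n + eT i n <= e n.
  move=> n1; rewrite /e (bigD1 i)//= lerDl sumr_ge0// => j _.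
  by rewrite addr_ge0 ?eI0 ?eT0.
have e_sum : summable_from1 e.
  apply: summable_from1_sum => i.
  apply: summable_from1D; apply: summable_from1D => //; exact: summable_from1Z.
have [a0 _ _] := h_alpha; have [b0 _ _] := h_beta.
apply: (@iterates_cvg_common_fixed_point _ _ _ hX K_closed K_convex _ I_ T_ e
  I_self T_self _ e_sum _ _ alpha_lo beta_lo alpha beta a0 b0
  _ _ alpha_sum beta_sum x y) => //.
- by move=> n n1; rewrite sumr_ge0// => i _; rewrite addr_ge0 ?eI0 ?eT0.
- move=> i n u v n1 Ku Kv; have [[mut0 _] [la0 _] _ hI] := I_tan i.
  have [_ hCi] := hC i.
  apply: total_bound_affine (hI _ _ _ Ku Kv n1) _ => //.
  + exact: mut0.
  + exact: la0.
  + exact: hCi.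
  + by apply: le_trans (eIT i n n1); rewrite lerDl eT0.
- move=> i n u v n1 Ku Kv; have [[mu0 _] [la0 _] _ hT] := T_tan i.
  have [_ hDi] := hD i.
  apply: total_bound_affine (hT _ _ _ Ku Kv n1) _ => //.
  + exact: mu0.
  + exact: la0.
  + exact: hDi.
  + by apply: le_trans (eIT i n n1); rewrite lerDr eI0.
- by move=> j n n1; case/andP: (alpha_range j n n1).
- by move=> j n n1; case/andP: (beta_range j n n1).
- by move=> n n1; rewrite y_def// (sum_with_head (beta^~ n)).
- by move=> n n1; rewrite x_def// (sum_with_head (alpha^~ n)).
Qed.
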